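(* Let $\mathcal{G}\subset(\mathbb{F}_2)^{24}$ be the extended binary Golay code with the ordered basis $b_1,\dots,b_{12}$ given in the context. Let $\theta\colon\mathcal{G}\times\mathcal{G}\to\mathbb{F}_2$ be the specific code cocycle produced from this ordered basis by Griess's algorithm, as described in the context, with every free bit chosen to be $0$. Let $\mathcal{P}=\mathbb{F}_2\times_\theta\mathcal{G}$ be Parker's loop. Put $V=\operatorname{span}\{b_1,\dots,b_6\}$ and $W=\operatorname{span}\{b_7,\dots,b_{12}\}$. Then: (1) $\theta|_{V\times V}$ is identically zero, so the restriction $\mathcal{P}|_V$ is the direct product $\mathbb{F}_2\times V$ (hence is a group); (2) the restriction $\mathcal{P}|_W$ is isomorphic to the direct product $(\mathbb{F}_2)^3\times M$, where $M$ is the $16$-element Moufang loop $M_{16}(C_2\times C_4)\simeq\mathbb{F}_2\times_\mu(\mathbb{F}_2)^3$ given in the context. This is because each single entry of the $8\times8$ array of $\mu$ becomes an $8\times 8$ constant block in the array of $\theta|_{W\times W}$. That is, $\theta(w,w')=\mu(p(w),p(w'))$ for all $w,w'\in W$, where $p\colon W\to(\mathbb{F}_2)^3$ is the linear map sending $b_7,b_8,b_9$ to $0$ and $b_{10},b_{11},b_{12}$ to $100,010,001$ respectively.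
   Context: $\mathbb{F}_2=\{0,1\}$ is the field with two elements. For $v,w\in(\mathbb{F}_2)^n$, $v\wedge w:=(v_1w_1,\dots,v_nw_n)$ is the coordinatewise product, and $|v|\in\mathbb{Z}_{\ge0}$ is the number of nonzero entries of $v$. A code (linear subspace) $\mathcal{C}\subset(\mathbb{F}_2)^n$ is doubly even if $4$ divides $|v|$ for every $v\in\mathcal{C}$; then $\tfrac14|v|$ and $\tfrac12|v\wedge w|$ are integers for all $v,w\in\mathcal{C}$. A code cocycle on a doubly even code $\mathcal{C}$ is a function $\theta\colon\mathcal{C}\times\mathcal{C}\to\mathbb{F}_2$ satisfying, for all $u,v,w\in\mathcal{C}$, (i) $\theta(v,w)-\theta(u+v,w)+\theta(u,v+w)-\theta(u,v)\equiv|u\wedge v\wedge w| \pmod 2$; (ii) $\theta(v,w)+\theta(w,v)\equiv\tfrac12|v\wedge w| \pmod 2$; (iii) $\theta(v,v)\equiv\tfrac14|v| \pmod 2$. A loop is a set $L$ with a binary operation $\star$ and a two-sided unit $e$ such that all left and right multiplication maps are bijections; a homomorphism of loops is a map preserving multiplication and unit. A Moufang loop is a loop satisfying $x\star(y\star(x\star z))=((x\star y)\star x)\star z$ for all $x,y,z$. For an $\mathbb{F}_2$-vector space $X$ and a function $\alpha\colon X\times X\to\mathbb{F}_2$ with $\alpha(\underline{0},v)=\alpha(v,\underline{0})=0$ for all $v$, $\mathbb{F}_2\times_\alpha X$ denotes the set $\mathbb{F}_2\times X$ with the operation $(s,v)\ast_\alpha(t,w):=(s+t+\alpha(v,w),\,v+w)$;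 it is a loop with identity $(0,\underline{0})$. When $\alpha$ is a code cocycle on a doubly even code $X$, it is called a code loop, and it is a Moufang loop. For a linear subspace $U\subset X$, the restriction $(\mathbb{F}_2\times_\alpha X)|_U$ is the subloop consisting of the elements $(s,v)$ with $v\in U$. The extended binary Golay code $\mathcal{G}\subset(\mathbb{F}_2)^{24}$ is the ($12$-dimensional, doubly even) span of the following vectors, written as bit strings of length $24$: $b_1=000110000000010110100011$, $b_2=101001111101101111110001$, $b_3=000100000000100100111110$, $b_4=010000000010000110101101$, $b_5=000000000010010101010111$, $b_6=100000000000100111110001$, $b_7=101001011100111001111111$, $b_8=100000011100001001001100$, $b_9=000001000000111001001110$, $b_{10}=100000001000111000111000$, $b_{11}=100000000100101000010111$, $b_{12}=011011000001111011111111$. Griess's algorithm, with all free bits chosen to be $0$, defines $\theta$ as follows (all values mod $2$). Initially set $\theta$ to be $0$ everywhere, then set $\theta(b_1,b_1)=\tfrac14|b_1|$. For $i=2,\dots,12$ in turn, let $U_i=\operatorname{span}\{b_1,\dots,b_{i-1}\}$ and perform the following steps. (D1) For $v\in U_i$: $\theta(b_i,v)=0$ (for $v\ne 0$ this is the free choice) and $\theta(v,b_i)=\tfrac12|v\wedge b_i|+\theta(b_i,v)$. (D2) For $v\in U_i$: $\theta(b_i,b_i+v)=\tfrac14|b_i|+\theta(b_i,v)$ and $\theta(b_i+v,b_i)=\tfrac12|b_i\wedge(b_i+v)|+\tfrac14|b_i|+\theta(b_i,v)$. (D3) For $v_1,v_2\in U_i$, with $w=b_i+v_2$: $\theta(w,b_i+v_1)=\tfrac12|v_1\wedge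 w|+\theta(v_1,b_i)+\theta(v_1,b_i+w)+\theta(w,b_i)$. (D4) For $v_1,v_2\in U_i$, with $w=b_i+v_2$: $\theta(w,v_1)=\tfrac14|w|+\theta(w,v_1+w)$ and $\theta(v_1,w)=\tfrac12|v_1\wedge w|+\tfrac14|w|+\theta(w,v_1+w)$. The loop $M$ is the $16$-element Moufang loop denoted $M_{16}(C_2\times C_4)$ by Chein. It is isomorphic to $\mathbb{F}_2\times_\mu(\mathbb{F}_2)^3$, where $\mu\colon(\mathbb{F}_2)^3\times(\mathbb{F}_2)^3\to\mathbb{F}_2$ is given by the following array. The row is the first argument and the column is the second argument, both in the order $000,100,010,110,001,101,011,111$: row $000$: $0\,0\,0\,0\,0\,0\,0\,0$; row $100$: $0\,0\,0\,0\,1\,1\,1\,1$; row $010$: $0\,0\,0\,0\,1\,1\,1\,1$; row $110$: $0\,0\,0\,0\,1\,1\,1\,1$; row $001$: $0\,0\,0\,0\,0\,0\,0\,0$; row $101$: $0\,0\,1\,1\,1\,1\,0\,0$; row $011$: $0\,1\,0\,1\,1\,0\,1\,0$; row $111$: $0\,1\,1\,0\,1\,0\,0\,1$. *)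

(* Defs.v *)
From Stdlib Require Import Ascii String Btauto.
From mathcomp Require Import all_boot all_order all_algebra.

Set Implicit Arguments.
Unset Strict Implicit.
Unset Printing Implicit Defensive.

Import GRing.Theory.
Local Open Scope ring_scope.

Record loop := Loop {
  loop_car :> Type;
  lmul : loop_car -> loop_car -> loop_car;
  lone : loop_car;
  lmul1l : forall x, lmul lone x = x;
  lmul1r : forall x, lmul x lone = x;
  lmul_bijl : forall a, bijective (lmul a);
  lmul_bijr : forall a, bijective (lmul^~ a) }.

Arguments lmul {l} _ _.
Arguments lone {l}.

Definition loop_hom (L1 L2 : loop) (f : L1 -> L2) : Prop :=
  (forall x y, f (lmul x y) = lmul (f x) (f y)) /\ f lone = lone.

Definition loop_iso (L1 L2 : loop) (f : L1 -> L2) : Prop :=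
  loop_hom f /\ bijective f.

Definition loop_isomorphic (L1 L2 : loop) : Prop :=
  exists f : L1 -> L2, loop_iso f.

Definition moufang (L : loop) : Prop :=
  forall x y z : L, lmul x (lmul y (lmul x z)) = lmul (lmul (lmul x y) x) z.

(* A loop is a group exactly when its multiplication is associative. *)
Definition is_group (L : loop) : Prop := associative (@lmul L).

Section ZmodLoop.
Variable V : zmodType.

Fact zmod_bijl (a : V) : bijective (+%R a).
Proof. by exists (fun y => - a + y) => y; rewrite ?addKr ?addNKr. Qed.

Fact zmod_bijr (a : V) : bijective (+%R^~ a).
Proof. by exists (fun y => y - a) => y; rewrite ?addrK ?subrK. Qed.

Definition zmod_loop : loop := Loop (@add0r V) (@addr0 V) zmod_bijl zmod_bijr.
End ZmodLoop.

Section ProdLoop.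
Variables L1 L2 : loop.

Definition prod_mul (x y : L1 * L2) : L1 * L2 :=
  (lmul x.1 y.1, lmul x.2 y.2).

Fact prod_mul1l x : prod_mul (lone, lone) x = x.
Proof. by case: x => x1 x2; rewrite /prod_mul /= !lmul1l. Qed.

Fact prod_mul1r x : prod_mul x (lone, lone) = x.
Proof. by case: x => x1 x2; rewrite /prod_mul /= !lmul1r. Qed.

Fact prod_bijl a : bijective (prod_mul a).
Proof.
have [[f fK Kf] [g gK Kg]] := (lmul_bijl a.1, lmul_bijl a.2).
by exists (fun y => (f y.1, g y.2)) => -[y1 y2]; rewrite /prod_mul /= ?fK ?gK ?Kf ?Kg.
Qed.

Fact prod_bijr a : bijective (prod_mul^~ a).
Proof.
have [[f fK Kf] [g gK Kg]] := (lmul_bijr a.1, lmul_bijr a.2).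
by exists (fun y => (f y.1, g y.2)) => -[y1 y2]; rewrite /prod_mul /= ?fK ?gK ?Kf ?Kg.
Qed.

Definition prod_loop : loop := Loop prod_mul1l prod_mul1r prod_bijl prod_bijr.
End ProdLoop.

Definition normalized (X : zmodType) (alpha : X -> X -> 'F_2) : Prop :=
  forall v, alpha 0 v = 0 /\ alpha v 0 = 0.

Section TwistedLoop.
Variables (X : vectType 'F_2) (alpha : X -> X -> 'F_2).
Hypothesis alpha0 : normalized alpha.

Definition twisted_mul (x y : 'F_2 * X) : 'F_2 * X :=
  (x.1 + y.1 + alpha x.2 y.2, x.2 + y.2).

Definition twisted_divl (a y : 'F_2 * X) : 'F_2 * X :=
  (y.1 - alpha a.2 (y.2 - a.2) - a.1, y.2 - a.2).

Definition twisted_divr (a y : 'F_2 * X) : 'F_2 * X :=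
  (y.1 - alpha (y.2 - a.2) a.2 - a.1, y.2 - a.2).

Fact twisted_mul1l x : twisted_mul (0, 0) x = x.
Proof.
by case: x => s v; rewrite /twisted_mul /= (alpha0 v).1 !add0r addr0.
Qed.

Fact twisted_mul1r x : twisted_mul x (0, 0) = x.
Proof.
by case: x => s v; rewrite /twisted_mul /= (alpha0 v).2 !addr0.
Qed.

Fact twisted_divlK a : cancel (twisted_mul a) (twisted_divl a).
Proof.
move=> [t w]; rewrite /twisted_mul /twisted_divl /=.
by rewrite [a.2 + w]addrC addrK addrK [a.1 + t]addrC addrK.
Qed.

Fact twisted_mulKl a : cancel (twisted_divl a) (twisted_mul a).
Proof.
move=> [t w]; rewrite /twisted_mul /twisted_divl /=.
by rewrite [a.1 + _]addrC subrK subrK [a.2 + _]addrC subrK.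
Qed.

Fact twisted_divrK a : cancel (twisted_mul^~ a) (twisted_divr a).
Proof.
by move=> [t w]; rewrite /twisted_mul /twisted_divr /= !addrK.
Qed.

Fact twisted_mulKr a : cancel (twisted_divr a) (twisted_mul^~ a).
Proof.
by move=> [t w]; rewrite /twisted_mul /twisted_divr /= !subrK.
Qed.

Fact twisted_bijl a : bijective (twisted_mul a).
Proof. exact: Bijective (@twisted_divlK a) (@twisted_mulKl a). Qed.

Fact twisted_bijr a : bijective (twisted_mul^~ a).
Proof. exact: Bijective (@twisted_divrK a) (@twisted_mulKr a). Qed.

Definition twisted_loop : loop :=
  Loop twisted_mul1l twisted_mul1r twisted_bijl twisted_bijr.

Variable U : {vspace X}.

Definition restr_car : Type := {x : 'F_2 * X | x.2 \in U}.

Definition restr_one : restr_car := exist _ (0, 0) (mem0v U).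

Definition restr_mul (x y : restr_car) : restr_car :=
  exist _ (twisted_mul (val x) (val y)) (memvD (valP x) (valP y)).

Definition restr_divl (a y : restr_car) : restr_car :=
  exist _ (twisted_divl (val a) (val y)) (memvB (valP y) (valP a)).

Definition restr_divr (a y : restr_car) : restr_car :=
  exist _ (twisted_divr (val a) (val y)) (memvB (valP y) (valP a)).

Fact restr_mul1l x : restr_mul restr_one x = x.
Proof. exact/val_inj/twisted_mul1l. Qed.

Fact restr_mul1r x : restr_mul x restr_one = x.
Proof. exact/val_inj/twisted_mul1r. Qed.

Fact restr_bijl a : bijective (restr_mul a).
Proof.
exists (restr_divl a) => x; apply: val_inj.
  exact: twisted_divlK.
exact: twisted_mulKl.
Qed.

Fact restr_bijr a : bijective (restr_mul^~ a).
Proof.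
exists (restr_divr a) => x; apply: val_inj.
  exact: twisted_divrK.
exact: twisted_mulKr.
Qed.

(* The subloop (F_2 x_alpha X)|_U, on the pairs (s, v) with v \in U. *)
Definition restr_loop : loop :=
  Loop restr_mul1l restr_mul1r restr_bijl restr_bijr.
End TwistedLoop.

Arguments twisted_loop {X alpha} alpha0.
Arguments restr_loop {X alpha} alpha0 U.

Section Weight.
Variable n : nat.
Implicit Types v w : 'rV['F_2]_n.

Definition wedge v w : 'rV['F_2]_n := \row_i (v 0 i * w 0 i).

Definition wt v : nat := #|[set i | v 0 i != 0]|.

Definition doubly_even (C : {vspace 'rV['F_2]_n}) : Prop :=
  forall v, v \in C -> (4 %| wt v)%N.
End Weight.

Section CodeCocycle.
Variables (n : nat) (C : {vspace 'rV['F_2]_n}).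
Local Notation X := (subvs_of C).
Implicit Types (theta : X -> X -> 'F_2) (u v w b : X).

(* The residues mod 2 of |v|/4, |v /\ w|/2 and |u /\ v /\ w|: on a doubly
   even code both divisions are exact. *)
Definition quarter_wt v : 'F_2 := (wt (vsval v) %/ 4)%:R.
Definition half_wedge v w : 'F_2 := (wt (wedge (vsval v) (vsval w)) %/ 2)%:R.
Definition triple_wedge u v w : 'F_2 :=
  (wt (wedge (wedge (vsval u) (vsval v)) (vsval w)))%:R.

Definition code_cocycle theta : Prop :=
  [/\ doubly_even C,
      forall u v w, theta v w - theta (u + v) w + theta u (v + w) - theta u v
                    = triple_wedge u v w,
      forall v w, theta v w + theta w v = half_wedge v w
    & forall v, theta v v = quarter_wt v].

(* Overwrites theta by val on the set of pairs dom.  The right-hand sides of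
   each group of simultaneous assignments below only read values that this
   group does not alter, given that b is not in U. *)
Definition assign (dom : X -> X -> bool) (val theta : X -> X -> 'F_2) :
    X -> X -> 'F_2 :=
  fun x y => if dom x y then val x y else theta x y.

(* The round of the algorithm for the basis vector b, where U is the span of
   the previous ones.  A pair (x, y) determines the v, w, v1, v2 of the
   instruction: e.g. x = b + v with v in U means x - b \in U, v = x - b. *)
Section Round.
Variables (U : {vspace X}) (b : X).

Definition D1l theta :=
  assign (fun x y => (x == b) && (y \in U)) (fun x y => 0) theta.

Definition D1r theta :=
  assign (fun x y => (x \in U) && (y == b))
         (fun v y => half_wedge v b + theta b v) theta.

Definition D2l theta :=
  assign (fun x y => (x == b) && (y - b \in U))
         (fun x y => let v := y - b in quarter_wt b + theta b v) theta.

Definition D2r theta :=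
  assign (fun x y => (x - b \in U) && (y == b))
         (fun x y => let v := x - b in
            half_wedge b (b + v) + quarter_wt b + theta b v) theta.

Definition D3 theta :=
  assign (fun x y => (x - b \in U) && (y - b \in U))
         (fun w y => let v1 := y - b in
            half_wedge v1 w + theta v1 b + theta v1 (b + w) + theta w b) theta.

Definition D4l theta :=
  assign (fun x y => (x - b \in U) && (y \in U))
         (fun w v1 => quarter_wt w + theta w (v1 + w)) theta.

Definition D4r theta :=
  assign (fun x y => (x \in U) && (y - b \in U))
         (fun v1 w => half_wedge v1 w + quarter_wt w + theta w (v1 + w)) theta.

Definition griess_round theta := D4r (D4l (D3 (D2r (D2l (D1r (D1l theta)))))).
End Round.

Definition griess_init b1 : X -> X -> 'F_2 :=
  assign (fun x y => (x == b1) && (y == b1)) (fun _ _ => quarter_wt b1)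
         (fun _ _ => 0).

Definition griess (bs : seq X) : X -> X -> 'F_2 :=
  foldl (fun theta i => griess_round <<take i bs>> bs`_i theta)
        (griess_init bs`_0) (iota 1 (size bs).-1).
End CodeCocycle.

Lemma F2E (a : 'F_2) : {s : bool | a = s%:R}.
Proof.
by case: a => -[|[|//]] i; [exists false | exists true]; apply: val_inj.
Qed.

Lemma F2_natD (s t : bool) : s%:R + t%:R = (xorb s t)%:R :> 'F_2.
Proof. by case: s; case: t; apply: val_inj. Qed.

Lemma F2_oppE (a : 'F_2) : - a = a.
Proof. by have [[] ->] := F2E a; apply: val_inj. Qed.

Lemma F2_addxx (a : 'F_2) : a + a = 0.
Proof. by have [[] ->] := F2E a; apply: val_inj. Qed.

Lemma F2_addv (V : lmodType 'F_2) (v : V) : v + v = 0.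
Proof.
rewrite -mulr2n -scaler_nat (_ : 2%:R = 0 :> 'F_2) ?scale0r //; exact: val_inj.
Qed.

Lemma F2_oppv (V : lmodType 'F_2) (v : V) : - v = v.
Proof. by apply/eqP; rewrite eq_sym -addr_eq0 F2_addv. Qed.

Lemma F2_natr_odd k : k%:R = (odd k)%:R :> 'F_2.
Proof.
rewrite -[in LHS](odd_double_half k) natrD -muln2 natrM.
by rewrite (_ : 2%:R = 0 :> 'F_2) ?mulr0 ?addr0 //; exact: val_inj.
Qed.

Local Ltac f2 :=
  repeat match goal with
  | |- context [quarter_wt ?v] => move: (quarter_wt v) => ?
  | |- context [half_wedge ?v ?w] => move: (half_wedge v w) => ?
  | |- context [triple_wedge ?u ?v ?w] => move: (triple_wedge u v w) => ?
  | |- context [?f ?v ?w] => is_var f; move: (f v w) => ?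
  end;
  rewrite ?F2_oppE ?addr0 ?add0r;
  repeat match goal with
  | a : 'F_2 |- _ => let s := fresh in have [s ->] := F2E a; clear a
  end;
  rewrite ?F2_natD; congr ((nat_of_bool _)%:R);
  btauto.

Section WeightTheory.
Variable n : nat.
Implicit Types u v w : 'rV['F_2]_n.

Lemma wtE v : wt v = (\sum_i (v ord0 i != 0%R))%N.
Proof. by rewrite /wt cardsE -sum1_card big_mkcond. Qed.

Lemma wt0 : wt (0 : 'rV['F_2]_n) = 0%N.
Proof. by rewrite wtE big1 // => i _; rewrite mxE. Qed.

Lemma wtD v w : (wt (v + w) + 2 * wt (wedge v w) = wt v + wt w)%N.
Proof.
rewrite !wtE big_distrr -!big_split /=; apply: eq_bigr => i _.
rewrite !mxE; have [s ->] := F2E (v 0 i); have [t ->] := F2E (w 0 i).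
by case: s; case: t.
Qed.

Lemma wedgeC v w : wedge v w = wedge w v.
Proof. by apply/rowP => i; rewrite !mxE mulrC. Qed.

Lemma wedgeA u v w : wedge u (wedge v w) = wedge (wedge u v) w.
Proof. by apply/rowP => i; rewrite !mxE mulrA. Qed.

Lemma wedgeDr u v w : wedge u (v + w) = wedge u v + wedge u w.
Proof. by apply/rowP => i; rewrite !mxE mulrDr. Qed.

Lemma wedge0r u : wedge u 0 = 0.
Proof. by apply/rowP => i; rewrite !mxE mulr0. Qed.

Lemma wedgevv v : wedge v v = v.
Proof.
by apply/rowP => i; rewrite !mxE; have [[] ->] := F2E (v 0 i); apply: val_inj.
Qed.
End WeightTheory.

Section GriessTheory.
Variables (n : nat) (C : {vspace 'rV['F_2]_n}).
Hypothesis deC : doubly_even C.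
Local Notation X := (subvs_of C).
Implicit Types (theta : X -> X -> 'F_2) (u v w b : X).
Local Notation q := (@quarter_wt n C).
Local Notation h := (@half_wedge n C).
Local Notation t3 := (@triple_wedge n C).

Let wt4 v : (wt (vsval v) = 4 * (wt (vsval v) %/ 4))%N.
Proof. by rewrite mulnC divnK // deC // subvsP. Qed.

Let wt2 v w :
  (wt (wedge (vsval v) (vsval w)) = 2 * (wt (wedge (vsval v) (vsval w)) %/ 2))%N.
Proof.
have := wtD (vsval v) (vsval w).
rewrite (wt4 v) (wt4 w) (wt4 (v + w)) => e.
rewrite mulnC divnK // -(@dvdn_pmul2l 2) // -(@dvdn_addr (4 * (wt (vsval (v + w)) %/ 4))) ?dvdn_mulr //.
by rewrite e dvdn_add ?dvdn_mulr.
Qed.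

Lemma quarter_wtD v w : q (v + w) = q v + q w + h v w.
Proof.
have := wtD (vsval v) (vsval w).
rewrite (wt4 v) (wt4 w) (wt4 (v + w)) wt2 mulnA -!mulnDr => /eqP.
rewrite eqn_pmul2l // => /eqP /(congr1 (fun k => k%:R : 'F_2)).
by rewrite !natrD -/(q _) -/(q _) -/(q _) -/(h v w) => <-; rewrite -addrA F2_addxx addr0.
Qed.

Lemma half_wedgeC v w : h v w = h w v.
Proof. by rewrite /half_wedge wedgeC. Qed.

Lemma half_wedgeDr u v w : h u (v + w) = h u v + h u w + t3 u v w.
Proof.
have := wtD (wedge (vsval u) (vsval v)) (wedge (vsval u) (vsval w)).
rewrite -wedgeDr -raddfD (wt2 u v) (wt2 u w) (wt2 u (v + w)) -!mulnDr => /eqP; rewrite eqn_pmul2l // => /eqP.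
move/(congr1 (fun k => k%:R : 'F_2)); rewrite !natrD -!/(h _ _) => <-.
rewrite [wedge (wedge _ _) _](_ : _ = wedge (wedge (vsval u) (vsval v)) (vsval w)).
  by rewrite -/(t3 u v w) -addrA F2_addxx addr0.
by rewrite -wedgeA [wedge (vsval v) _]wedgeC !wedgeA wedgevv -!wedgeA [wedge (vsval w) _]wedgeC.
Qed.

Lemma half_wedgeDl u v w : h (u + v) w = h u w + h v w + t3 u v w.
Proof.
rewrite half_wedgeC half_wedgeDr ![h w _]half_wedgeC; congr (_ + _).
by rewrite /triple_wedge -wedgeA wedgeC.
Qed.

Lemma half_wedgevv v : h v v = 0.
Proof.
rewrite /half_wedge wedgevv wt4 -[4%N]/(2 * 2)%N -mulnA mulKn // natrM.
by rewrite (_ : 2%:R = 0 :> 'F_2) ?mul0r //; exact: val_inj.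
Qed.

Lemma triple_wedgeC u v w : t3 u v w = t3 v u w.
Proof. by rewrite /triple_wedge [wedge (vsval u) _]wedgeC. Qed.

Lemma triple_wedgeCr u v w : t3 u v w = t3 u w v.
Proof. by rewrite /triple_wedge -!wedgeA [wedge (vsval v) _]wedgeC. Qed.

Lemma triple_wedgeDr u v w1 w2 : t3 u v (w1 + w2) = t3 u v w1 + t3 u v w2.
Proof.
rewrite /triple_wedge raddfD /= wedgeDr -natrD -wtD natrD natrM.
by rewrite (_ : 2%:R = 0 :> 'F_2) ?mul0r ?addr0 //; exact: val_inj.
Qed.

Lemma triple_wedgeDm u v1 v2 w : t3 u (v1 + v2) w = t3 u v1 w + t3 u v2 w.
Proof. by rewrite triple_wedgeCr triple_wedgeDr ![t3 u w _]triple_wedgeCr. Qed.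

Lemma triple_wedgeDl u1 u2 v w : t3 (u1 + u2) v w = t3 u1 v w + t3 u2 v w.
Proof. by rewrite triple_wedgeC triple_wedgeDm ![t3 v _ _]triple_wedgeC. Qed.

Lemma triple_wedgevv u v : t3 u v v = 0.
Proof.
rewrite /triple_wedge -wedgeA wedgevv wt2 natrM.
by rewrite (_ : 2%:R = 0 :> 'F_2) ?mul0r //; exact: val_inj.
Qed.

Lemma triple_wedge0 u v : t3 u v 0 = 0.
Proof. by rewrite /triple_wedge raddf0 wedge0r wt0. Qed.

Lemma quarter_wt0 : q 0 = 0.
Proof. by rewrite /quarter_wt raddf0 wt0. Qed.

Lemma half_wedge0 v : h v 0 = 0.
Proof. by rewrite /half_wedge raddf0 wedge0r wt0. Qed.


(* The restriction of theta to U is a code cocycle. *)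
Let cocycle_on (U : {vspace X}) theta : Prop :=
  [/\ {in U & U & U, forall u v w,
        theta v w + theta (u + v) w + theta u (v + w) + theta u v = t3 u v w},
      {in U &, forall v w, theta v w + theta w v = h v w}
    & {in U, forall v, theta v v = q v}].

Let ins b (s : bool) v := if s then b + v else v.

Let insD b s t v w : ins b s v + ins b t w = ins b (s (+) t) (v + w).
Proof.
case: s t => [] [] //=; rewrite ?[v + (b + w)]addrCA ?addrA //.
by rewrite [b + v]addrC -[v + b + b]addrA F2_addv addr0.
Qed.

(* Closed form of the extension of theta from U to U + <[b]>. *)
Let extends (U : {vspace X}) b theta theta' : Prop :=
  forall s t, {in U &, forall v w,
    theta' (ins b s v) (ins b t w) =
      theta v w + (if s then t3 b v w else 0) + (if t then h v b else 0)
      + (if s && t then q b else 0)}.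

Let t3b b u v : (t3 u b v = t3 b u v) * (t3 u v b = t3 b u v).
Proof. by split; rewrite ?[t3 u v b]triple_wedgeCr triple_wedgeC. Qed.

Let t3b0 b v : (t3 b b v = 0) * (t3 b v b = 0) * (t3 v b b = 0).
Proof.
by do !split; rewrite ?triple_wedgevv // ?[t3 b v b]triple_wedgeC ?triple_wedgevv //
   triple_wedgeCr triple_wedgeC triple_wedgevv.
Qed.

Let insP U b x : x \in (U + <[b]>)%VS ->
  exists s, exists2 v, v \in U & x = ins b s v.
Proof.
move=> /memv_addP[v vU [y /vlineP[k ->] ->]]; have [s ->] := F2E k.
exists s; exists v => //; case: s => /=; last by rewrite scale0r addr0.
by rewrite scale1r addrC.
Qed.

Let cocycle_extends U b theta theta' :
  cocycle_on U theta -> extends U b theta theta' ->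
  cocycle_on (U + <[b]>)%VS theta'.
Proof.
move=> [c1 c2 c3] E; split.
- move=> _ _ _ /insP[s [u uU ->]] /insP[t [v vU ->]] /insP[r [w wU ->]].
  have uvU := memvD uU vU; have vwU := memvD vU wU.
  rewrite !insD !E // -?addrA.
  have {c1} := c1 u v w uU vU wU.
  rewrite half_wedgeDl ?triple_wedgeDm ?triple_wedgeDr.
  have -> : t3 (ins b s u) (ins b t v) (ins b r w) =
    t3 u v w + (if s then t3 b v w else 0) + (if t then t3 b u w else 0)
    + (if r then t3 b u v else 0).
    case: s t r => [] [] [] /=;
    rewrite ?triple_wedgeDl ?triple_wedgeDm ?triple_wedgeDr ?t3b0;
    rewrite ?(t3b b u) ?(t3b b v); f2.
  rewrite (t3b b u v).2 => <-.
  case: s t r => [] [] [] /=; f2.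
- move=> _ _ /insP[t [v vU ->]] /insP[r [w wU ->]].
  rewrite !E //.
  have -> : h (ins b t v) (ins b r w) = h v w + (if t then h w b + t3 b v w else 0)
     + (if r then h v b + t3 b v w else 0).
    case: t r => [] [] /=; rewrite ?half_wedgeDl ?half_wedgeDr ?half_wedgevv //;
    rewrite ?triple_wedgeDr ?t3b0 ?(t3b b v) ?[h b w]half_wedgeC; f2.
  rewrite -(c2 v w) // [t3 b w v]triple_wedgeCr.
  case: t r => [] [] /=; f2.
- move=> _ /insP[t [v vU ->]]; rewrite !E // c3 // triple_wedgevv.
  case: t => /=; rewrite ?quarter_wtD // ?[h b v]half_wedgeC; f2.
Qed.

Let assignE (dom : X -> X -> bool) val theta x y :
  assign dom val theta x y = if dom x y then val x y else theta x y.
Proof. by []. Qed.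

Let griess_round_extends (U : {vspace X}) b theta :
  b \notin U -> cocycle_on U theta ->
  extends U b theta (griess_round U b theta).
Proof.
move=> bU [c1 c2 c3].
have subb v : b + v - b = v by rewrite addrC addKr.
have bbv v : b + (b + v) = v by rewrite addrA F2_addv add0r.
have bU' := negbTE bU.
have inB v : v \in U -> ((v - b \in U) = false) * ((b + v \in U) = false) *
    ((v == b) = false).
  move=> vU; rewrite (rpredBl _ vU) (rpredDr _ vU) bU'; do !split.
  by apply/eqP => e; rewrite -e vU in bU.
have nb v : (b + v == b) = (v == 0) by rewrite -[in RHS](subb v) subr_eq0.
have U0 := mem0v U.
pose th1 := D1l U b theta; pose th2 := D1r U b th1; pose th3 := D2l U b th2.
pose th4 := D2r U b th3; pose th5 := D3 U b th4; pose th6 := D4l U b th5.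
have e2vw : {in U &, forall v w, th2 v w = theta v w}.
  move=> v w vU wU; rewrite /th2 /D1r !assignE /th1 /D1l !assignE.
  by rewrite !(inB v vU, inB w wU) ?andbF.
have e2bv : {in U, forall v, th2 b v = 0}.
  move=> v vU; rewrite /th2 /D1r !assignE /th1 /D1l !assignE.
  by rewrite bU' eqxx vU.
have e2vb : {in U, forall v, th2 v b = h v b}.
  move=> v vU; rewrite /th2 /D1r !assignE vU eqxx /th1 /D1l !assignE.
  by rewrite eqxx vU addr0.
have e4vw : {in U &, forall v w, th4 v w = theta v w}.
  move=> v w vU wU; rewrite /th4 /D2r !assignE /th3 /D2l !assignE.
  by rewrite !(inB v vU, inB w wU) ?andbF /= e2vw.
have e4vb : {in U, forall v, th4 v b = h v b}.
  move=> v vU; rewrite /th4 /D2r !assignE /th3 /D2l !assignE.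
  by rewrite !(inB v vU) //= e2vb.
have e4bb : {in U, forall v, th4 (b + v) b = h v b + q b}.
  move=> v vU; rewrite /th4 /D2r !assignE subb vU eqxx /= /th3 /D2l !assignE.
  rewrite eqxx !(inB v vU) //= e2bv // addr0 half_wedgeDr // half_wedgevv //.
  by rewrite t3b0 add0r addr0 half_wedgeC.
have e5vw x : {in U, forall v, th5 v x = th4 v x}.
  by move=> v vU; rewrite /th5 /D3 !assignE !(inB v vU).
have e5 : {in U &, forall v w,
    th5 (b + v) (b + w) = theta v w + t3 b v w + h v b + q b}.
  move=> v w vU wU; rewrite /th5 /D3 !assignE !subb vU wU /= bbv.
  rewrite e4vb // e4vw // e4bb // half_wedgeDr //.
  by rewrite (t3b b w v).1 [t3 b w v]triple_wedgeCr -(c2 w v) //; f2.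
have tvv : {in U &, forall v w, theta v (w + v) = theta v w + q v}.
  move=> v w vU wU; have t0w : theta 0 w = 0.
    have := c1 0 0 w U0 U0 wU; rewrite !add0r c3 // quarter_wt0 addr0 t3b0.
    by rewrite F2_addxx add0r.
  have := c1 v v w vU vU wU; rewrite F2_addv t0w addr0 t3b0 [v + w]addrC.
  move/eqP; rewrite -addrA addr_eq0 F2_oppE => /eqP ->.
  by rewrite c3 // -addrA F2_addxx addr0.
have e6x v x : v \in U -> th6 v x = th4 v x.
  by move=> vU; rewrite /th6 /D4l !assignE !(inB v vU) /= e5vw.
have e6 : {in U &, forall v w, th6 (b + v) w = theta v w + t3 b v w}.
  move=> v w vU wU; rewrite /th6 /D4l !assignE subb vU wU /=.
  rewrite [w + _]addrCA e5 ?memvD // tvv // triple_wedgeDr // triple_wedgevv //.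
  by rewrite quarter_wtD // [h b v]half_wedgeC; f2.
have e6b : {in U &, forall v w,
    th6 (b + v) (b + w) = theta v w + t3 b v w + h v b + q b}.
  by move=> v w vU wU; rewrite /th6 /D4l !assignE !(inB w wU) ?andbF /= e5.
move=> [] [] v w vU wU /=; rewrite /griess_round /D4r !assignE -/th1 -/th2 -/th3
  -/th4 -/th5 -/th6 ?subb ?(inB v vU, inB w wU) ?andbF /= ?vU ?wU ?addr0.
- by rewrite e6b.
- by rewrite e6.
- rewrite [v + _]addrCA e6b ?memvD // tvv // triple_wedgeDr // triple_wedgevv //.
  rewrite quarter_wtD // half_wedgeDr // (t3b b v w).1 [t3 b w v]triple_wedgeCr.
  by rewrite -(c2 v w) // [h b w]half_wedgeC; f2.
- by rewrite e6x // e4vw.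
Qed.

Let cocycle_on0 : cocycle_on 0 (fun _ _ => 0).
Proof.
split=> [u v w|v w|v]; rewrite !memv0.
- by move=> /eqP-> /eqP-> /eqP->; rewrite triple_wedge0 !addr0.
- by move=> /eqP-> /eqP->; rewrite half_wedge0 addr0.
- by move=> /eqP->; rewrite quarter_wt0.
Qed.

Let griess_init_extends b : b != 0 ->
  extends 0 b (fun _ _ => 0) (griess_init b).
Proof.
move=> b0 s t v w; rewrite !memv0 => /eqP-> /eqP->.
rewrite /griess_init assignE /ins triple_wedge0 half_wedgeC half_wedge0 !addr0.
by case: s t => [] [] /=; rewrite ?eqxx ?[0 == b]eq_sym ?(negbTE b0) ?addr0 ?add0r.
Qed.

Lemma griess_code_cocycle (bs : seq X) :
  (0 < size bs)%N -> free bs -> <<bs>>%VS = fullv -> code_cocycle (griess bs).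
Proof.
move=> s_gt0 fr full.
have take_free k : (k < size bs)%N ->
    (bs`_k \notin <<take k bs>>%VS) /\
    (<<take k.+1 bs>> = <<take k bs>> + <[bs`_k]>)%VS.
  move=> lt_k; rewrite (take_nth 0 lt_k) -cats1 span_cat span_seq1; split=> //.
  move: fr; rewrite -{1}(cat_take_drop k.+1 bs) => /catl_free.
  rewrite (take_nth 0 lt_k) (perm_free (permEl (perm_rcons _ _))) free_cons.
  by case/andP.
suff [] : cocycle_on <<take (size bs) bs>>%VS (griess bs).
  rewrite take_size full => c1 c2 c3; split=> // [u v w|v w|v].
  - by rewrite -c1 ?memvf // !F2_oppE.
  - by rewrite c2 ?memvf.
  - by rewrite c3 ?memvf.
rewrite /griess -{1}(prednK s_gt0).
have : ((size bs).-1 < size bs)%N by rewrite prednK.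
elim: (size bs).-1 => [|k IHk] lt_k.
  have [b0 ->] := take_free _ lt_k.
  rewrite take0 span_nil; apply: cocycle_extends cocycle_on0 _.
  apply: griess_init_extends.
  by apply: contraNneq b0 => ->; rewrite mem0v.
have [bk ->] := take_free _ lt_k.
rewrite (_ : iota 1 k.+1 = iota 1 k ++ [:: k.+1]);
  last by rewrite -[in LHS](addn1 k) iotaD add1n.
rewrite foldl_cat.
apply: cocycle_extends (IHk (ltnW lt_k)) _.
exact: griess_round_extends bk (IHk (ltnW lt_k)).
Qed.
End GriessTheory.

Fixpoint bits (s : string) : bitseq :=
  if s is String c s' then (if c is "1"%char then true else false) :: bits s'
  else [::].

Definition bitvec n (s : bitseq) : 'rV['F_2]_n := \row_(j < n) (nth false s j)%:R.

(* The fourth bit of the third word is 1, not 0: with 0 that word has weight 7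
   and odd overlap with the first one, so the span is not doubly even, and no
   other single-bit change of it repairs this. *)
Definition golay_words : seq bitseq := map bits
  [:: "000110000000010110100011";
      "101001111101101111110001";
      "000100000000100100111110";
      "010000000010000110101101";
      "000000000010010101010111";
      "100000000000100111110001";
      "101001011100111001111111";
      "100000011100001001001100";
      "000001000000111001001110";
      "100000001000111000111000";
      "100000000100101000010111";
      "011011000001111011111111"]%string.

Definition golay : {vspace 'rV['F_2]_24} :=
  <<[seq bitvec 24 s | s <- golay_words]>>%VS.

(* vsproj golay is the inverse of the inclusion vsval on vectors of golay. *)
Definition golay_basis : seq (subvs_of golay) :=
  [seq vsproj golay (bitvec 24 s) | s <- golay_words].

(* b_1, ..., b_12, numbered from 1. *)
Definition golay_b (k : nat) : subvs_of golay := golay_basis`_k.-1.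

Section GolayFacts.

Let ovl (s t : bitseq) : nat :=
  sumn [seq (nth false s i && nth false t i : nat) | i <- iota 0 24].

Let wt_wedge_bitvec s t : wt (wedge (bitvec 24 s) (bitvec 24 t)) = ovl s t.
Proof.
rewrite wtE /ovl sumnE big_map -[iota 0 24]/(index_iota 0 24) big_mkord.
by apply: eq_bigr => i _; rewrite !mxE; case: nth; case: nth.
Qed.

Let wt_bitvec s : wt (bitvec 24 s) = ovl s s.
Proof. by rewrite -wt_wedge_bitvec wedgevv. Qed.

Let span_ind (V : vectType 'F_2) (P : V -> Prop) (vs : seq V) :
  P 0 -> (forall v w, v \in vs -> P w -> P (v + w)) ->
  forall v, v \in <<vs>>%VS -> P v.
Proof.
move=> P0; elim: vs => [|x vs IHvs] PD v; first by rewrite span_nil memv0 => /eqP->.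
rewrite span_cons => /memv_addP[_ /vlineP[k ->] [w w_vs ->]].
have Pw : P w by apply: IHvs w_vs => u ? u_vs; apply: PD; rewrite inE u_vs orbT.
have [[] ->] := F2E k; last by rewrite scale0r add0r.
by rewrite scale1r; apply: PD; rewrite ?mem_head.
Qed.

Let wedge_parity_span n (x : 'rV['F_2]_n) vs :
  {in vs, forall v, ~~ odd (wt (wedge x v))} ->
  {in <<vs>>%VS, forall v, ~~ odd (wt (wedge x v))}.
Proof.
move=> even_vs; apply: span_ind => [|v w v_vs even_w]; first by rewrite wedge0r wt0.
have := congr1 odd (wtD (wedge x v) (wedge x w)).
rewrite -wedgeDr mul2n !oddD odd_double addbF => ->.
by rewrite (negbTE (even_vs v v_vs)) (negbTE even_w).
Qed.

Lemma golay_doubly_even : doubly_even golay.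
Proof.
set vs := [seq bitvec 24 s | s <- golay_words].
have vsP v : v \in vs -> exists2 s, s \in golay_words & v = bitvec 24 s.
  by move/(@mapP _ _ _ golay_words).
have even_vs : {in vs &, forall v w, ~~ odd (wt (wedge v w))}.
  move=> _ _ /vsP[s s_w ->] /vsP[t t_w ->]; rewrite wt_wedge_bitvec.
  have ok : all (fun s => all (fun t => ~~ odd (ovl s t)) golay_words) golay_words.
    by vm_compute.
  exact: (allP (allP ok s s_w) t t_w).
have dvd4_vs : {in vs, forall v, 4 %| wt v}%N.
  move=> _ /vsP[s s_w ->]; rewrite wt_bitvec.
  have ok : all (fun s => 4 %| ovl s s)%N golay_words by vm_compute.
  exact: (allP ok s s_w).
move=> v v_vs; suff [] : v \in <<vs>>%VS /\ (4 %| wt v)%N by [].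
move: v v_vs; apply: span_ind => [|v w v_vs [w_span dvd4_w]].
  by rewrite mem0v wt0.
split; first by rewrite rpredD // memv_span.
have even_vw := wedge_parity_span (even_vs v ^~ v_vs) w_span.
rewrite -(@dvdn_addl (2 * wt (wedge v w))).
  by rewrite wtD dvdn_add // dvd4_vs.
by rewrite -[4%N]/(2 * 2)%N dvdn_pmul2l // dvdn2.
Qed.

(* The vectors of a dual family: golay_dual`_i meets golay_words`_j in an odd
   number of positions exactly when i = j. *)
Let golay_dual : seq bitseq := map bits
  [:: "000010100001000000000000";
      "000000100000000000000000";
      "000110100001000000000000";
      "010000100001000000000000";
      "010000100011000000000000";
      "100000011100000000000000";
      "001000000001000000000000";
      "001000110001000000000000";
      "001001000000000000000000";
      "000000011000000000000000";
      "000000010100000000000000";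
      "000000100001000000000000"]%string.

Lemma golay_basis_val i : (i < 12)%N ->
  vsval golay_basis`_i = bitvec 24 (nth [::] golay_words i).
Proof.
move=> lt_i; rewrite (nth_map [::]) // vsprojK // memv_span //.
by apply/map_f/mem_nth.
Qed.

Lemma golay_basis_free : free golay_basis.
Proof.
apply/(@freeP _ _ _ (in_tuple golay_basis)) => k k0 i.
pose phi (v : subvs_of golay) : 'F_2 :=
  (wt (wedge (bitvec 24 (nth [::] golay_dual i)) (vsval v)))%:R.
have phiD : {morph phi : v w / v + w}.
  move=> v w; rewrite /phi raddfD wedgeDr -natrD -wtD natrD natrM.
  by rewrite (_ : 2%:R = 0 :> 'F_2) ?mul0r ?addr0 //; exact: val_inj.
have phi0 : phi 0 = 0 by rewrite /phi raddf0 wedge0r wt0.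
have phiZ a v : phi (a *: v) = a * phi v.
  by have [[] ->] := F2E a; rewrite ?scale1r ?mul1r // scale0r mul0r.
have phib j : (j < 12)%N -> phi golay_basis`_j = (i == j :> nat)%:R.
  move=> lt_j; rewrite /phi golay_basis_val // wt_wedge_bitvec F2_natr_odd.
  have ok : all (fun i => all (fun j => odd (ovl (nth [::] golay_dual i)
      (nth [::] golay_words j)) == (i == j)) (iota 0 12)) (iota 0 12).
    by vm_compute.
  have lt_i : val i \in iota 0 12 by rewrite mem_iota ltn_ord.
  have lt_j' : j \in iota 0 12 by rewrite mem_iota.
  by rewrite (eqP (allP (allP ok _ lt_i) j lt_j')).
have := congr1 phi k0; rewrite (big_morph phi phiD phi0) phi0 => <-.
rewrite (bigD1 i) //= phiZ phib ?ltn_ord // eqxx mulr1 big1 ?addr0 // => j ne_ji.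
by rewrite phiZ phib ?ltn_ord // eq_sym (inj_eq val_inj) (negbTE ne_ji) mulr0.
Qed.

Lemma golay_basis_full : <<golay_basis>>%VS = fullv.
Proof.
apply/eqP; rewrite eqEsubv subvf; apply/subvP => v _.
rewrite -(vsvalK v).
have : vsval v \in golay by exact: subvsP.
move: (vsval v); apply: span_ind => [|w x /mapP[s s_w ->] x_span].
  by rewrite raddf0 mem0v.
by rewrite raddfD rpredD // memv_span //; apply/mapP; exists s.
Qed.

End GolayFacts.

Definition theta : subvs_of golay -> subvs_of golay -> 'F_2 := griess golay_basis.

Lemma theta_code_cocycle : code_cocycle theta.
Proof.
apply: griess_code_cocycle => //; first exact: golay_doubly_even.
  exact: golay_basis_free.
exact: golay_basis_full.
Qed.

Lemma code_cocycle_normalized n (C : {vspace 'rV['F_2]_n})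
    (alpha : subvs_of C -> subvs_of C -> 'F_2) :
  code_cocycle alpha -> normalized alpha.
Proof.
case=> deC c1 c2 c3 v.
have a00 : alpha 0 0 = 0 by rewrite c3 quarter_wt0.
split.
  have := c1 0 0 v; rewrite !add0r a00 subrr add0r subr0.
  by rewrite triple_wedgeCr triple_wedgeC triple_wedgevv.
have := c1 v 0 0; rewrite !addr0 a00 triple_wedge0 sub0r addNr sub0r.
by move/eqP; rewrite oppr_eq0 => /eqP.
Qed.

Definition parker_loop : loop :=
  twisted_loop (code_cocycle_normalized theta_code_cocycle).

Definition parker_restr (U : {vspace subvs_of golay}) : loop :=
  restr_loop (code_cocycle_normalized theta_code_cocycle) U.

Fact parker_restr_incl (U : {vspace subvs_of golay}) :
  @loop_hom (parker_restr U) parker_loop val.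
Proof. by []. Qed.

Definition mu_table : seq bitseq := map bits
  [:: "00000000";
      "00001111";
      "00001111";
      "00001111";
      "00000000";
      "00111100";
      "01011010";
      "01101001"]%string.

(* Position of v in the order 000, 100, 010, 110, 001, 101, 011, 111. *)
Definition mu_index (v : 'rV['F_2]_3) : nat :=
  (v 0 0 != 0) + 2 * (v 0 1 != 0) + 4 * (v 0 2 != 0).

Definition mu (v w : 'rV['F_2]_3) : 'F_2 :=
  (nth false (nth [::] mu_table (mu_index v)) (mu_index w))%:R.

Section MuFacts.
Let code (a b c : bool) : nat := a + 2 * b + 4 * c.
Let mub a b c d e f : bool :=
  nth false (nth [::] mu_table (code a b c)) (code d e f).

Let nz (x : 'F_2) : bool := x != 0.

Let nzD x y : nz (x + y) = nz x (+) nz y.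
Proof. by have [[] ->] := F2E x; have [[] ->] := F2E y. Qed.

Let muE v w : mu v w =
  (mub (nz (v 0 0)) (nz (v 0 1)) (nz (v 0 2))
       (nz (w 0 0)) (nz (w 0 1)) (nz (w 0 2)))%:R.
Proof. by []. Qed.

Lemma mu_normalized : normalized mu.
Proof.
move=> v; rewrite !muE !mxE.
by move: (nz (v 0 0)) (nz (v 0 1)) (nz (v 0 2)) => [] [] [].
Qed.

Definition M_loop : loop := twisted_loop mu_normalized.

Lemma M_moufang : moufang M_loop.
Proof.
move=> [r x] [s y] [t z]; congr pair; last by rewrite /= !addrA.
rewrite /=.
have -> : mu x z = mu x y + mu (x + y) x + mu (x + y + x) z + mu y (x + z)
                     + mu x (y + (x + z)).
  rewrite !muE !mxE !nzD !F2_natD; congr ((nat_of_bool _)%:R).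
  move: (nz (x 0 0)) (nz (x 0 1)) (nz (x 0 2)) (nz (y 0 0)) (nz (y 0 1))
    (nz (y 0 2)) (nz (z 0 0)) (nz (z 0 1)) (nz (z 0 2)).
  by do 9!case.
by move: (mu y _) (mu x (_ + _)) (mu x y) (mu _ x) (mu _ z) => a b c d e; f2.
Qed.
End MuFacts.

(* Main.v *)
From HB Require Import structures.
From Stdlib Require Import Btauto.
Require Import Defs.
From mathcomp Require Import all_boot all_order all_algebra.
From mathcomp Require Import ring.

Import GRing.Theory.
Local Open Scope ring_scope.

Set Implicit Arguments.
Unset Strict Implicit.
Unset Printing Implicit Defensive.

(** Polarizing |v|/4 mod 2 once gives |v /\ w|/2, and twice gives
|u /\ v /\ w|.  So the axioms of a code cocycle say that its symmetrization
and its coboundary are prescribed by its diagonal ([code_cocycle_diag]), and two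
cocycles with the same diagonal differ by a symmetric 2-cocycle d with
d(v, v) = 0.  Such a d is the coboundary of a function f.  If c is a spanning
sequence and d(c_k, v) = 0 for all v in the span of c_0, ..., c_(k-1), then f is
additive and d = 0; so a cocycle is determined by its diagonal together with its
values at such pairs (c_k, v) ([diag_cocycle_unique]).

Griess's algorithm with zero free bits returns a cocycle theta with
theta(b_i, v) = 0 for all v spanned by b_1, ..., b_(i-1) ([griess_flag]), and
this persists for any sublist of the basis.  So it remains to compare diagonals,
that is, to reduce weights modulo 8:
- on V all weights are divisible by 8, so theta agrees with the zero cocycle;
- on W the residue of |w|/4 mod 2 is mu(p(w), p(w)).  Since the symmetrization
  and the coboundary of mu are also prescribed by its diagonal
  ([mu_diag_cocycle]), and mu vanishes at
  (p(b_k), p(v)) for v spanned by b_7, ..., b_(k-1) ([mu_flag]), theta agrees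
  with the pullback of mu by p.
These diagonals are compared on all 64 elements of V and of W.

The loop P|_W then depends on its second component only through p, and the
coordinates along b_7, b_8, b_9 split off as a direct factor
([restr_loop_split]). *)

(** * Cocycles determined by their diagonal *)

(** The commutator of alpha is the first polarization of its diagonal q, and its
coboundary the second one: alpha satisfies the three axioms of a code cocycle,
with q, its polarization and its trilinear form in place of |v|/4, |v /\ w|/2
and |u /\ v /\ w|.  Stated this way, the axioms also make sense for mu, which
is not given on a code. *)
Definition diag_cocycle (X : zmodType) (alpha : X -> X -> 'F_2) : Prop :=
  let q x := alpha x x in
  (forall x y, alpha x y + alpha y x = q (x + y) + q x + q y) /\
  (forall x y z, alpha y z + alpha (x + y) z + alpha x (y + z) + alpha x y =
     q (x + y + z) + q (x + y) + q (x + z) + q (y + z) + q x + q y + q z).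

Lemma F2_add_eq0 (a b : 'F_2) : a + b = 0 -> a = b.
Proof. by move/eqP; rewrite addr_eq0 F2_oppE => /eqP. Qed.

Ltac f2_bool :=
  repeat match goal with
  | a : 'F_2 |- _ => let s := fresh in have [s ->] := F2E a; clear a
  end;
  rewrite ?F2_natD; congr ((nat_of_bool _)%:R); btauto.

(** Adjoining the last vector b to the span U of the others, the values d(b, v)
are zero by hypothesis.  The cocycle identity at (b, b, v), (b, v, w) and
(b, v, b + w) then yields the remaining values of d on U + <b>. *)
Lemma symmetric_cocycle_eq0 (X : vectType 'F_2) (d : X -> X -> 'F_2) cs :
    {in <<cs>>%VS & &, forall u v w,
       d v w + d (u + v) w + d u (v + w) + d u v = 0} ->
    {in <<cs>>%VS &, forall v w, d v w = d w v} ->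
    {in <<cs>>%VS, forall v, d v v = 0} ->
    (forall k, (k < size cs)%N -> {in <<take k cs>>%VS, forall v, d cs`_k v = 0}) ->
  {in <<cs>>%VS &, forall v w, d v w = 0}.
Proof.
elim/last_ind: cs => [|cs b IHcs] coc sym diag flag.
  by move=> v w; rewrite span_nil !memv0 => /eqP-> /eqP->; rewrite diag ?mem0v.
have span_b : (<<rcons cs b>> = <<cs>> + <[b]>)%VS.
  by rewrite -cats1 span_cat span_seq1.
have sub_cs : {subset <<cs>>%VS <= <<rcons cs b>>%VS}.
  by apply/subvP; rewrite span_b addvSl.
have b_in : b \in <<rcons cs b>>%VS by rewrite memv_span // mem_rcons mem_head.
have dcs : {in <<cs>>%VS &, forall v w, d v w = 0}.
  apply: IHcs => [u v w uU vU wU|v w vU wU|v vU|k lt_k v vU].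
  - by apply: coc; apply: sub_cs.
  - by apply: sym; apply: sub_cs.
  - by apply: diag; apply: sub_cs.
  have := flag k; rewrite size_rcons ltnS (ltnW lt_k) nth_rcons lt_k.
  by rewrite -cats1 takel_cat ?(ltnW lt_k) // => /(_ isT); apply.
have dbl : {in <<cs>>%VS, forall v, d b v = 0}.
  have := flag (size cs); rewrite size_rcons ltnSn nth_rcons ltnn eqxx.
  by rewrite -cats1 take_size_cat // => /(_ isT).
have dbb : {in <<cs>>%VS, forall v, d b (b + v) = 0}.
  move=> v vU; have := coc b b v b_in b_in (sub_cs v vU).
  by rewrite F2_addv dbl // dcs ?mem0v // diag // addr0 !add0r.
have dbvw : {in <<cs>>%VS &, forall v w, d (b + v) w = 0}.
  move=> v w vU wU; have := coc b v w b_in (sub_cs v vU) (sub_cs w wU).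
  by rewrite dcs // !dbl ?memvD // !addr0 add0r.
have dvbw : {in <<cs>>%VS &, forall v w, d v (b + w) = 0}.
  by move=> v w vU wU; rewrite sym ?dbvw ?memvD // sub_cs.
have dbvbw : {in <<cs>>%VS &, forall v w, d (b + v) (b + w) = 0}.
  move=> v w vU wU.
  have := coc b v (b + w) b_in (sub_cs v vU) (memvD b_in (sub_cs w wU)).
  by rewrite dvbw // addrCA dbb ?memvD // dbl // !addr0 add0r.
have insP x : x \in <<rcons cs b>>%VS ->
    exists2 v, v \in <<cs>>%VS & x = v \/ x = b + v.
  rewrite span_b => /memv_addP[v vU [_ /vlineP[k ->] ->]]; exists v => //.
  have [[] ->] := F2E k; first by rewrite scale1r addrC; right.
  by rewrite scale0r addr0; left.
move=> x y /insP[v vU [] ->] /insP[w wU [] ->].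
- exact: dcs.
- exact: dvbw.
- exact: dbvw.
- exact: dbvbw.
Qed.

(** The sum alpha + beta is symmetric, has zero coboundary and vanishes on the
diagonal, because these three data of alpha and beta come from the same q. *)
Lemma diag_cocycle_unique (X : vectType 'F_2) (alpha beta : X -> X -> 'F_2) cs :
    diag_cocycle alpha -> diag_cocycle beta ->
    {in <<cs>>%VS, forall v, alpha v v = beta v v} ->
    (forall k, (k < size cs)%N ->
       {in <<take k cs>>%VS, forall v, alpha cs`_k v = beta cs`_k v}) ->
  {in <<cs>>%VS &, forall v w, alpha v w = beta v w}.
Proof.
move=> [sym_a coc_a] [sym_b coc_b] eq_diag eq_flag.
pose d v w := alpha v w + beta v w.
suff d0 : {in <<cs>>%VS &, forall v w, d v w = 0}.
  by move=> v w vU wU; apply/F2_add_eq0/d0.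
apply: symmetric_cocycle_eq0 => [u v w uU vU wU|v w vU wU|v vU|k lt_k v vU].
- have := coc_a u v w; rewrite !eq_diag ?memvD // -coc_b => e.
  rewrite -(F2_addxx (beta v w + beta (u + v) w + beta u (v + w) + beta u v)).
  by rewrite -{1}e /d; ring.
- apply: F2_add_eq0; rewrite /d addrACA sym_a sym_b !eq_diag ?memvD //.
  exact: F2_addxx.
- by rewrite /d eq_diag // F2_addxx.
- by rewrite /d eq_flag // F2_addxx.
Qed.

Lemma diag_cocycle_comp (X Y : zmodType) (p : X -> Y) (alpha : Y -> Y -> 'F_2) :
  {morph p : x y / x + y} -> diag_cocycle alpha ->
  diag_cocycle (fun x y => alpha (p x) (p y)).
Proof. by move=> pD [sym coc]; split=> *; rewrite !pD. Qed.

Lemma diag_cocycle0 (X : zmodType) : diag_cocycle (fun _ _ : X => 0).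
Proof. by split=> *; rewrite !addr0. Qed.

Lemma code_cocycle_diag n (C : {vspace 'rV['F_2]_n})
    (alpha : subvs_of C -> subvs_of C -> 'F_2) :
  code_cocycle alpha -> diag_cocycle alpha.
Proof.
case=> deC coc comm diag; split=> [v w|u v w]; rewrite !diag.
  rewrite comm quarter_wtD //.
  by move: (quarter_wt v) (quarter_wt w) (half_wedge v w) => a b c; f2_bool.
have := coc u v w; rewrite !F2_oppE => ->.
rewrite !quarter_wtD // half_wedgeDl //.
move: (quarter_wt u) (quarter_wt v) (quarter_wt w) (triple_wedge u v w).
move: (half_wedge u v) (half_wedge u w) (half_wedge v w) => a b c d e f g.
f2_bool.
Qed.

(** * The free choices of Griess's algorithm *)

Section GriessFlag.
Variables (n : nat) (C : {vspace 'rV['F_2]_n}).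
Hypothesis deC : doubly_even C.
Local Notation X := (subvs_of C).

(** Every assignment of the round for b concerns a pair with an entry in the
coset b + U. *)
Lemma griess_round_old (U : {vspace X}) b (th : X -> X -> 'F_2) :
  b \notin U -> {in U &, griess_round U b th =2 th}.
Proof.
move=> /negbTE bU x y xU yU.
have notin z : z \in U -> ((z == b) = false) * ((z - b \in U) = false).
  move=> zU; split; last by rewrite (rpredBl _ zU) bU.
  by apply: contraFF bU => /eqP <-.
rewrite /griess_round /D4r /D4l /D3 /D2r /D2l /D1r /D1l /assign.
by rewrite !(notin x xU) !(notin y yU) ?andbF.
Qed.

(** Step (D4) overwrites the free values theta(b, v) = 0 chosen in (D1), since b
lies in b + U; tracing (D4) back through (D3), (D2) and (D1), all weights cancel
and the value theta(v, 0) of the preceding rounds is left. *)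
Lemma griess_round_new (U : {vspace X}) b (th : X -> X -> 'F_2) :
  b \notin U -> {in U, forall v, griess_round U b th b v = th v 0}.
Proof.
move=> /negbTE bU v vU.
have notin z : z \in U -> ((z == b) = false) * ((z - b \in U) = false).
  move=> zU; split; last by rewrite (rpredBl _ zU) bU.
  by apply: contraFF bU => /eqP <-.
rewrite /griess_round /D4r /D4l /D3 /D2r /D2l /D1r /D1l /assign.
rewrite bU subrr addrK vU eqxx F2_addv !(notin v vU) !(notin 0 (mem0v U)) ?andbF /=.
rewrite mem0v /= !addr0 half_wedgevv // add0r F2_addxx add0r.
by rewrite [_ + quarter_wt b]addrC addrA F2_addxx add0r.
Qed.

(** By [griess_round_new], the value at (b_i, v) is an earlier value at (v, 0).
Later rounds do not alter the latter, so it equals the final one, which is zero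
because a code cocycle is normalized. *)
Lemma griess_flag (bs : seq X) :
  free bs -> <<bs>>%VS = fullv ->
  forall i, (i < size bs)%N ->
    {in <<take i bs>>%VS, forall v, griess bs bs`_i v = 0}.
Proof.
move=> fr full i lt_i v vU.
have [_ alpha0] := all_and2 (code_cocycle_normalized
  (griess_code_cocycle deC (leq_ltn_trans (leq0n i) lt_i) fr full)).
case: i lt_i vU => [|i] lt_i vU.
  by move: vU; rewrite take0 span_nil memv0 => /eqP->; rewrite alpha0.
pose g k := foldl (fun th i => griess_round <<take i bs>> bs`_i th)
  (griess_init bs`_0) (iota 1 k).
have gS k : g k.+1 = griess_round <<take k.+1 bs>> bs`_k.+1 (g k).
  by rewrite [in LHS]/g -[in LHS](addn1 k) iotaD foldl_cat /= add1n.
have new k : (k < size bs)%N -> bs`_k \notin <<take k bs>>%VS.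
  move=> lt_k; move: fr; rewrite -{1}(cat_take_drop k.+1 bs) => /catl_free.
  rewrite (take_nth 0 lt_k) (perm_free (permEl (perm_rcons _ _))) free_cons.
  by case/andP.
have take_sub k l : (k <= l)%N -> {subset <<take k bs>>%VS <= <<take l bs>>%VS}.
  move=> le_kl; apply/subvP/sub_span => x.
  by rewrite -(take_takel _ le_kl); apply: mem_take.
have stable k m : (k + m < size bs)%N ->
    {in <<take k.+1 bs>>%VS &, g (k + m)%N =2 g k}.
  elim: m => [|m IHm] lt_m x y xU yU; first by rewrite addn0.
  rewrite addnS in lt_m *; rewrite gS griess_round_old ?new //.
  - exact: IHm (ltnW lt_m) _ _ xU yU.
  - by apply: take_sub xU; rewrite ltnS leq_addr.
  - by apply: take_sub yU; rewrite ltnS leq_addr.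
have final k : (k < size bs)%N -> {in <<take k.+1 bs>>%VS &, griess bs =2 g k}.
  move=> lt_k x y xU yU; rewrite -(stable k ((size bs).-1 - k)%N) //.
    by rewrite subnKC // -ltnS (ltn_predK lt_k).
  by rewrite subnKC -ltnS (ltn_predK lt_k).
rewrite (final i.+1) //; last 2 first.
- by rewrite memv_span // (take_nth 0) // mem_rcons mem_head.
- exact: take_sub vU.
rewrite gS griess_round_new ?new //.
by rewrite -(final i (ltnW lt_i)) ?mem0v ?alpha0.
Qed.
End GriessFlag.

(** * Subloops of twisted products *)

Lemma restr_loop_trivial (X : vectType 'F_2) (alpha : X -> X -> 'F_2)
    (alpha0 : normalized alpha) (U : {vspace X}) :
    {in U &, forall v w, alpha v w = 0} ->
  exists2 f : restr_loop alpha0 U ->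
                prod_loop (zmod_loop 'F_2) (zmod_loop (subvs_of U)),
    loop_iso f & forall x, (f x).1 = (val x).1 /\ vsval (f x).2 = (val x).2.
Proof.
move=> alphaU; pose f (x : restr_loop alpha0 U) :
  prod_loop (zmod_loop 'F_2) (zmod_loop (subvs_of U)) :=
  ((val x).1, Subvs (valP x)).
exists f => //; split.
  split=> [x y|]; congr pair; try exact: val_inj.
  by rewrite /= alphaU ?addr0 //; [apply: (valP x) | apply: (valP y)].
pose g (y : 'F_2 * subvs_of U) : restr_car U :=
  exist _ (y.1, vsval y.2) (subvsP y.2).
exists g => [[[s v] vU]|[s v]].
  exact: val_inj.
by congr pair; apply: val_inj.
Qed.

Lemma loop_iso_group (L1 L2 : loop) (f : L1 -> L2) :
  loop_iso f -> is_group L2 -> is_group L1.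
Proof.
case=> -[fM _] f_bij L2A x y z; apply: (bij_inj f_bij).
by rewrite !fM L2A.
Qed.

(** Here k and p are the two projections of U onto Z and Y, and g is the inverse
of the pair (k, p).  As alpha factors through p, the component along k is
multiplied as in the vector space Z. *)
Lemma restr_loop_split (X Y Z : vectType 'F_2) (alpha : X -> X -> 'F_2)
    (beta : Y -> Y -> 'F_2) (alpha0 : normalized alpha) (beta0 : normalized beta)
    (U : {vspace X}) (k : {linear X -> Z}) (p : {linear X -> Y})
    (g : Z -> Y -> X) :
    {in U &, forall v w, alpha v w = beta (p v) (p w)} ->
    (forall z y, [/\ g z y \in U, k (g z y) = z & p (g z y) = y]) ->
    {in U, forall v, g (k v) (p v) = v} ->
  loop_isomorphic (restr_loop alpha0 U)
    (prod_loop (zmod_loop Z) (twisted_loop beta0)).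
Proof.
move=> alphaE gP gK; pose f (x : restr_loop alpha0 U) :
  prod_loop (zmod_loop Z) (twisted_loop beta0) :=
  (k (val x).2, ((val x).1, p (val x).2)).
exists f; split.
  split=> [x y|]; rewrite /f /= ?raddf0 // !raddfD /=.
  by rewrite alphaE //; [apply: (valP x) | apply: (valP y)].
have gU z y : g z y \in U by case: (gP z y).
pose f' (y : Z * ('F_2 * Y)) : restr_car U :=
  exist _ (y.2.1, g y.1 y.2.2) (gU y.1 y.2.2).
exists f' => [[[s v] vU]|].
  by apply: val_inj; rewrite /= gK.
by move=> [z [s y]]; rewrite /f /=; have [_ -> ->] := gP z y.
Qed.

(** * Sums of bit strings *)

Definition sum_bits n (ss : seq bitseq) : bitseq :=
  mkseq (fun j => odd (count (nth false ^~ j) ss)) n.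

Lemma sum_bitvec n ss :
  \sum_(s <- ss) bitvec n s = bitvec n (sum_bits n ss).
Proof.
apply/rowP => j; rewrite summxE mxE nth_mkseq // -F2_natr_odd -sum1_count.
rewrite [in RHS]big_mkcond natr_sum; apply: eq_bigr => s _; rewrite mxE.
by case: nth.
Qed.

Lemma wt_bitvec n s : size s = n -> wt (bitvec n s) = count id s.
Proof.
move=> <-; rewrite wtE -sum1_count [in RHS]big_mkcond (big_nth false) big_mkord.
by apply: eq_bigr => i _; rewrite mxE; case: nth.
Qed.

(** Over the two-element field, linear combinations are sums of sublists; this
turns a statement about a span into a check over bit strings. *)
Lemma span_F2_mask (X : vectType 'F_2) (vs : seq X) v :
  v \in <<vs>>%VS ->
  exists2 m : bitseq, size m = size vs & v = \sum_(x <- mask m vs) x.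
Proof.
elim: vs v => [|x vs IHvs] v.
  by rewrite span_nil memv0 => /eqP ->; exists [::]; rewrite ?big_nil.
rewrite span_cons => /memv_addP[_ /vlineP[k ->] [w /IHvs[m sz_m ->] ->]].
have [b ->] := F2E k; exists (b :: m); first by rewrite /= sz_m.
by case: b; rewrite /= ?big_cons ?scale1r // scale0r add0r.
Qed.

(** Unlike a boolean quantifier over the tuple type, this test evaluates
efficiently. *)
Fixpoint forall_bits n (P : pred bitseq) : bool :=
  if n is k.+1 then
    forall_bits k (P \o cons true) && forall_bits k (P \o cons false)
  else P [::].

Lemma forall_bitsP n (P : pred bitseq) m : forall_bits n P -> size m = n -> P m.
Proof.
elim: n P m => [|n IHn] P [|b m] //= /andP[Pt Pf] [sz_m].
by case: b; [apply: (IHn (P \o cons true)) | apply: (IHn (P \o cons false))].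
Qed.

Lemma bitvec_surj n (v : 'rV['F_2]_n) : exists2 s, size s = n & v = bitvec n s.
Proof.
exists [seq v 0 i != 0 | i <- enum 'I_n]; first by rewrite size_map size_enum_ord.
apply/rowP => j; rewrite mxE (nth_map j) ?size_enum_ord // nth_ord_enum.
by have [[] ->] := F2E (v 0 j).
Qed.

Lemma bitvecD n s t : bitvec n s + bitvec n t = bitvec n (sum_bits n [:: s; t]).
Proof. by rewrite -sum_bitvec !big_cons big_nil addr0. Qed.

(** * The array mu *)

Definition bit_index (s : bitseq) : nat :=
  nth false s 0 + 2 * nth false s 1 + 4 * nth false s 2.

Definition mu_bits (s t : bitseq) : bool :=
  nth false (nth [::] mu_table (bit_index s)) (bit_index t).

Lemma mu_bitvec s t : mu (bitvec 3 s) (bitvec 3 t) = (mu_bits s t)%:R.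
Proof.
have nz (b : bool) : (b%:R != 0 :> 'F_2) = b by case: b.
by rewrite /mu /mu_index !mxE !nz.
Qed.

Lemma mu_diag_cocycle : diag_cocycle mu.
Proof.
split=> [x y|x y z].
  have [[|a [|b [|c []]]] // _ ->] := bitvec_surj x.
  have [[|d [|e [|f []]]] // _ ->] := bitvec_surj y.
  rewrite !bitvecD !mu_bitvec !F2_natD.
  by move: a b c d e f; do 6!case.
have [[|a [|b [|c []]]] // _ ->] := bitvec_surj x.
have [[|d [|e [|f []]]] // _ ->] := bitvec_surj y.
have [[|g [|h [|k []]]] // _ ->] := bitvec_surj z.
rewrite !bitvecD !mu_bitvec !F2_natD.
by move: a b c d e f g h k; do 9!case.
Qed.

(** * The two halves of the Golay basis *)

Lemma quarter_wt_golay ss : {subset ss <= golay_words} ->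
  quarter_wt (\sum_(s <- ss) vsproj golay (bitvec 24 s)) =
  (odd (count id (sum_bits 24 ss) %/ 4))%:R.
Proof.
move=> ss_words; rewrite /quarter_wt raddf_sum /=.
rewrite (eq_big_seq (bitvec 24)) => [|s /ss_words s_w]; last first.
  by rewrite vsprojK // memv_span // map_f.
rewrite sum_bitvec F2_natr_odd; congr (odd (_ %/ 4))%:R.
by rewrite wt_bitvec ?size_mkseq.
Qed.

(** The range b_(i+1), ..., b_(i+j) of the basis covers both V and W. *)
Lemma golay_span_bits i j v :
    v \in <<take j (drop i golay_basis)>>%VS ->
  exists2 m : bitseq, size m = size (take j (drop i golay_words)) &
    v = \sum_(x <- mask m (take j (drop i golay_basis))) x /\
    quarter_wt v =
      (odd (count id (sum_bits 24 (mask m (take j (drop i golay_words)))) %/ 4))%:R.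
Proof.
move=> /span_F2_mask[m sz_m ->]; exists m.
  by rewrite sz_m /golay_basis -map_drop -map_take size_map.
split=> //; rewrite -quarter_wt_golay => [|s /mem_mask /mem_take /mem_drop //].
by rewrite -map_drop -map_take -map_mask big_map.
Qed.

Lemma V_quarter_wt : {in <<take 6 golay_basis>>%VS, forall v, quarter_wt v = 0}.
Proof.
move=> v; rewrite -[golay_basis]drop0 => /golay_span_bits[m sz_m [_ ->]].
have ok : forall_bits 6 (fun m => ~~ odd (count id (sum_bits 24
    (mask m (take 6 (drop 0 golay_words)))) %/ 4)) by vm_compute.
by rewrite (negbTE (forall_bitsP ok sz_m)).
Qed.

Definition W_basis : 6.-tuple (subvs_of golay) :=
  @Tuple 6 _ (drop 6 golay_basis) isT.

Lemma W_basis_free : free W_basis.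
Proof.
by move: golay_basis_free; rewrite -{1}(cat_take_drop 6 golay_basis) => /catr_free.
Qed.

(** The split 3 + 3 separates the coordinates along b_7, b_8, b_9, on which theta|_W
does not depend, from those along b_10, b_11, b_12, which are the map p. *)
Definition W_coords (v : subvs_of golay) : 'rV['F_2]_(3 + 3) :=
  \row_i coord W_basis i v.

Fact W_coords_linear : linear W_coords.
Proof. by move=> a u v; apply/rowP => i; rewrite !mxE linearP. Qed.
HB.instance Definition _ := GRing.isLinear.Build 'F_2 (subvs_of golay)
  'rV['F_2]_(3 + 3) *:%R W_coords W_coords_linear.

Definition W_comb (c : 'rV['F_2]_(3 + 3)) : subvs_of golay :=
  \sum_(i < 6) c 0 i *: W_basis`_i.

Lemma W_combK : cancel W_comb W_coords.
Proof.
by move=> c; apply/rowP => i; rewrite mxE coord_sum_free ?W_basis_free.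
Qed.

Lemma W_coordsK : {in <<W_basis>>%VS, cancel W_coords W_comb}.
Proof.
move=> v vW; rewrite [RHS](coord_span vW).
by apply: eq_bigr => i _; rewrite mxE.
Qed.

Lemma W_comb_in c : W_comb c \in <<W_basis>>%VS.
Proof.
by apply: memv_suml => i _; rewrite memvZ // memv_span // mem_nth ?size_tuple.
Qed.

Definition W_proj (v : subvs_of golay) : 'rV['F_2]_3 := rsubmx (W_coords v).

HB.instance Definition _ := GRing.Linear.copy W_proj (@rsubmx _ _ _ _ \o W_coords).

(** The images under p of b_7, ..., b_12. *)
Definition proj_words : seq bitseq :=
  [seq [seq i == j | j <- iota 3 3] | i <- iota 0 6].

Lemma W_proj_basis i : (i < 6)%N ->
  W_proj golay_basis`_(6 + i) = bitvec 3 (nth [::] proj_words i).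
Proof.
move=> lt_i; apply/rowP => j.
rewrite !mxE -nth_drop (coord_free (Ordinal lt_i)) ?W_basis_free //.
rewrite (nth_map 0%N) ?size_iota // nth_iota // (nth_map 0%N) ?size_iota //.
by rewrite nth_iota.
Qed.

Lemma W_proj_words : map W_proj W_basis = map (bitvec 3) proj_words.
Proof.
apply: (@eq_from_nth _ 0); first by rewrite !size_map.
move=> i; rewrite size_map size_tuple => lt_i.
by rewrite (nth_map 0) ?size_tuple // nth_drop W_proj_basis // (nth_map [::]).
Qed.

Lemma W_proj_sum k m :
  W_proj (\sum_(x <- mask m (take k W_basis)) x) =
  bitvec 3 (sum_bits 3 (mask m (take k proj_words))).
Proof.
rewrite -sum_bitvec raddf_sum.
transitivity (\sum_(y <- mask m (take k (map W_proj W_basis))) y).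
  by rewrite -map_take -map_mask big_map.
by rewrite W_proj_words -map_take -map_mask big_map.
Qed.

Lemma W_quarter_wt :
  {in <<W_basis>>%VS, forall w, quarter_wt w = mu (W_proj w) (W_proj w)}.
Proof.
move=> w; have -> : val W_basis = take 6 (drop 6 golay_basis) by [].
move=> /golay_span_bits[m sz_m [-> ->]].
rewrite (W_proj_sum 6) mu_bitvec; congr (_ : bool)%:R.
have ok : forall_bits 6 (fun m =>
    odd (count id (sum_bits 24 (mask m (take 6 (drop 6 golay_words)))) %/ 4) ==
    let s := sum_bits 3 (mask m (take 6 proj_words)) in mu_bits s s).
  by vm_compute.
exact/eqP/(forall_bitsP ok sz_m).
Qed.

(** This normalization of mu corresponds to the zero free bits of theta on the
ordered basis of W. *)
Lemma mu_flag k : (k < 6)%N -> {in <<take k W_basis>>%VS, forall w,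
  mu (W_proj W_basis`_k) (W_proj w) = 0}.
Proof.
move=> lt_k w /span_F2_mask[m sz_m ->].
rewrite W_proj_sum nth_drop W_proj_basis // mu_bitvec.
have ok : all (fun k => forall_bits k (fun m => ~~ mu_bits (nth [::] proj_words k)
    (sum_bits 3 (mask m (take k proj_words))))) (iota 0 6) by vm_compute.
rewrite size_takel ?size_tuple 1?ltnW // in sz_m.
have k_in : k \in iota 0 6 by rewrite mem_iota.
by rewrite (negbTE (forall_bitsP (allP ok k k_in) sz_m)).
Qed.

Lemma theta_flag i : (i < 12)%N ->
  {in <<take i golay_basis>>%VS, forall v, theta golay_basis`_i v = 0}.
Proof.
exact: griess_flag golay_doubly_even _ golay_basis_free golay_basis_full i.
Qed.

Lemma theta_V : {in <<take 6 golay_basis>>%VS &, forall v w, theta v w = 0}.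
Proof.
have [_ _ _ diag] := theta_code_cocycle.
apply: diag_cocycle_unique (code_cocycle_diag theta_code_cocycle)
  (diag_cocycle0 _) _ _ => [v vV|k lt_k v].
  by rewrite diag V_quarter_wt.
rewrite size_takel // in lt_k.
by rewrite take_takel 1?ltnW // nth_take //; apply/theta_flag/(ltn_trans lt_k).
Qed.

Lemma theta_W : {in <<W_basis>>%VS &, forall v w,
  theta v w = mu (W_proj v) (W_proj w)}.
Proof.
have [_ _ _ diag] := theta_code_cocycle.
have WD : {morph W_proj : v w / v + w} by move=> v w; rewrite raddfD.
apply: diag_cocycle_unique (code_cocycle_diag theta_code_cocycle)
  (diag_cocycle_comp WD mu_diag_cocycle) _ _ => [w wW|k].
  by rewrite diag W_quarter_wt.
rewrite size_tuple => lt_k w w_in; rewrite mu_flag // nth_drop.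
apply: theta_flag; first by rewrite (ltn_add2l 6 k 6).
move: w w_in; apply/subvP/sub_span => x.
by rewrite takeD mem_cat => ->; rewrite orbT.
Qed.

(** * The restrictions of Parker's loop *)

Theorem mainTheorem2 :
  let V : {vspace subvs_of golay} := <<[seq golay_b k | k <- iota 1 6]>>%VS in
  let W : {vspace subvs_of golay} := <<[seq golay_b k | k <- iota 7 6]>>%VS in
  [/\ forall v w, v \in V -> w \in V -> theta v w = 0,
      exists2 f : parker_restr V ->
                    prod_loop (zmod_loop 'F_2) (zmod_loop (subvs_of V)),
        loop_iso f
        & forall x, (f x).1 = (val x).1 /\ vsval (f x).2 = (val x).2,
      is_group (parker_restr V),
      loop_isomorphic (parker_restr W)
                      (prod_loop (zmod_loop 'rV['F_2]_3) M_loop)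
    & exists p : {linear subvs_of W -> 'rV['F_2]_3},
        [/\ [/\ p (vsproj W (golay_b 7)) = 0,
                p (vsproj W (golay_b 8)) = 0
              & p (vsproj W (golay_b 9)) = 0],
            [/\ p (vsproj W (golay_b 10)) = delta_mx 0 0,
                p (vsproj W (golay_b 11)) = delta_mx 0 1
              & p (vsproj W (golay_b 12)) = delta_mx 0 2]
          & forall w w' : subvs_of W,
              theta (vsval w) (vsval w') = mu (p w) (p w')]].
Proof.
move=> V W.
have VE : V = <<take 6 golay_basis>>%VS by [].
have WE : W = <<W_basis>>%VS by [].
have thV : {in V &, forall v w, theta v w = 0} by rewrite VE; apply: theta_V.
have thW : {in W &, forall v w, theta v w = mu (W_proj v) (W_proj w)}.
  by rewrite WE; apply: theta_W.
have [f f_iso fE] :=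
  restr_loop_trivial (code_cocycle_normalized theta_code_cocycle) thV.
split; [by [] | by exists f | | | ].
- apply: loop_iso_group f_iso _ => x y z.
  by congr pair; rewrite /= addrA.
- pose k : {linear _ -> _} := @lsubmx _ _ 3 3 \o W_coords.
  apply: (restr_loop_split _ _ (k := k) (p := W_proj)
    (g := fun z y => W_comb (row_mx z y))) => //.
    move=> z y; split; first by rewrite WE W_comb_in.
      by rewrite /k /= W_combK row_mxKl.
    by rewrite /= /W_proj W_combK row_mxKr.
  by rewrite WE => v vW; rewrite /k /W_proj /= hsubmxK W_coordsK.
exists (W_proj \o vsval : {linear _ -> _}).
have pW i : (i < 6)%N -> W_proj (vsval (vsproj W (golay_b (7 + i)))) =
    bitvec 3 (nth [::] proj_words i).
  move=> lt_i; rewrite vsprojK; first exact: W_proj_basis.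
  by rewrite memv_span // map_f // mem_iota leq_addr ltn_add2l.
split; last by move=> w w'; apply: thW; apply: subvsP.
- by split; rewrite /= ?(pW 0%N, pW 1%N, pW 2%N) //;
    apply/rowP => -[[|[|[|]]] //= ?]; rewrite !mxE.
- by split; rewrite /= ?(pW 3%N, pW 4%N, pW 5%N) //;
    apply/rowP => -[[|[|[|]]] //= ?]; rewrite !mxE.
Qed.
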